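(* Let $n \ge 2$, and let $\lambda = (\lambda_1, \dots, \lambda_m)$ be a partition of $n$. Suppose that $\mathbf{w}_1, \dots, \mathbf{w}_k$ form a linearly independent set of weighting vectors in $\mathbb{Q}^m$ such that $\overline{\mathbf{w}_1}, \dots, \overline{\mathbf{w}_k} \in \mathbb{Q}^n$ are sum-zero vectors. If $\mathbf{r}_1, \dots, \mathbf{r}_k$ are any sum-zero vectors in $\mathbb{Q}^n$, then there exist infinitely many profiles $\mathbf{p} \in M^\lambda$ such that $T_{\mathbf{w}_i}(\mathbf{p}) = \mathbf{r}_i$ for all $1 \le i \le k$.
   Context: A partition $\lambda = (\lambda_1,\dots,\lambda_m)$ of $n$ is a sequence of positive integers $\lambda_1 \ge \cdots \ge \lambda_m$ with sum $n$. A tabloid of shape $\lambda$ is an ordered sequence of $m$ pairwise disjoint subsets (''rows'') of $\{1,\dots,n\}$, the $j$th row having size $\lambda_j$, whose union is $\{1,\dots,n\}$ (the elements $1,\dots,n$ label the candidates). $X^\lambda$ is the set of tabloids of shape $\lambda$, and $M^\lambda$ is the $\mathbb{Q}$-vector space of all functions $\mathbf{p}: X^\lambda \to \mathbb{Q}$, called profiles. A weighting vector for $\lambda$ is a vector $\mathbf{w} = [w_1,\dots,w_m]^t \in \mathbb{Q}^m$. The associated positional voting map is the linear map $T_{\mathbf{w}}: M^\lambda \to \mathbb{Q}^n$ whose $i$th coordinate is $[T_{\mathbf{w}}(\mathbf{p})]_i = \sum_{x \in X^\lambda} w_{j(i,x)}\,\mathbf{p}(x)$, where $j(i,x)$ is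 the index of the row of $x$ containing $i$. For $\mathbf{w} \in \mathbb{Q}^m$, $\overline{\mathbf{w}} \in \mathbb{Q}^n$ is the vector whose first $\lambda_1$ entries equal $w_1$, whose next $\lambda_2$ entries equal $w_2$, and so on. A vector in $\mathbb{Q}^n$ is sum-zero if its entries sum to $0$. *)

(* Defs.v *)
From mathcomp Require Import all_boot all_order all_algebra.

Set Implicit Arguments.
Unset Strict Implicit.
Unset Printing Implicit Defensive.

Import GRing.Theory.
Local Open Scope ring_scope.

(* All indices are shifted by one: candidates 1, ..., n are the elements of 'I_n
   and rows 1, ..., m are the elements of 'I_m. *)

Definition is_partition (n m : nat) (lambda : m.-tuple nat) : bool :=
  [&& sorted geq lambda, all (fun a => 0 < a)%N lambda & sumn lambda == n].

Definition is_tabloid (n m : nat) (lambda : m.-tuple nat)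
    (x : m.-tuple {set 'I_n}) : bool :=
  [&& [forall j, #|tnth x j| == tnth lambda j],
      [forall j, forall j', (j != j') ==> [disjoint tnth x j & tnth x j']] &
      \bigcup_(j < m) tnth x j == [set: 'I_n]].

Definition tabloid (n m : nat) (lambda : m.-tuple nat) : Type :=
  {x : m.-tuple {set 'I_n} | is_tabloid lambda x}.

Definition profile (n m : nat) (lambda : m.-tuple nat) : Type :=
  {ffun tabloid n lambda -> rat}.

Lemma tabloid_row_exists (n m : nat) (lambda : m.-tuple nat)
    (x : tabloid n lambda) (i : 'I_n) : exists j : 'I_m, i \in tnth (val x) j.
Proof.
have /and3P[_ _ /eqP xT] := valP x.
have /bigcupP[j _ ij] : i \in \bigcup_(j < m) tnth (val x) j by rewrite xT inE.
by exists j.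
Qed.

Definition row_index (n m : nat) (lambda : m.-tuple nat)
    (x : tabloid n lambda) (i : 'I_n) : 'I_m :=
  xchoose (tabloid_row_exists x i).

Lemma row_indexP (n m : nat) (lambda : m.-tuple nat)
    (x : tabloid n lambda) (i : 'I_n) (j : 'I_m) :
  (i \in tnth (val x) j) = (j == row_index x i).
Proof.
have ri : i \in tnth (val x) (row_index x i).
  exact: (xchooseP (tabloid_row_exists x i)).
apply/idP/eqP => [ij | ->] //.
apply/eqP; apply: contraLR ij => jN.
have /and3P[_ /forallP/(_ j)/forallP/(_ (row_index x i)) + _] := valP x.
by move=> /implyP/(_ jN) /disjointFl ->.
Qed.

Definition voting_map (n m : nat) (lambda : m.-tuple nat) (w : 'cV[rat]_m)
    (p : profile n lambda) : 'cV[rat]_n :=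
  \col_(i < n) \sum_(x : tabloid n lambda) w (row_index x i) 0 * p x.

(* The sequence below has length sumn lambda, so that nth never uses its default
   value when lambda is a partition of n. *)
Definition expand (n m : nat) (lambda : m.-tuple nat) (w : 'cV[rat]_m) :
    'cV[rat]_n :=
  \col_(i < n)
    nth 0 (flatten [seq nseq (tnth lambda j) (w j 0) | j <- enum 'I_m]) i.

Definition sum_zero (n : nat) (v : 'cV[rat]_n) : Prop := \sum_(i < n) v i 0 = 0.

(* Main.v *)
Require Import Defs.
From mathcomp Require Import all_boot all_order all_algebra.
From mathcomp Require Import classical_sets cardinality.
From mathcomp Require Import perm ring.

(** The system is solved by an explicit profile, and shifting that profile by a
    constant gives infinitely many others.

    Averages over all tabloids are easy because relabelling candidates permutes
    the tabloids (sum_relabel).  Write x(i) for the row of candidate i in x, and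
    N for the number of tabloids.  If a function F on rows satisfies
    sum_j lambda_j F(j) = 0, then for any function G on rows the number
    S(i, i') = sum_x F(x(i)) G(x(i')) takes only two values: one on the diagonal,
    one off it.  The diagonal value is (N/n) sum_j lambda_j F(j) G(j), and since
    sum_i' G(x(i')) does not depend on x while sum_x F(x(i)) = 0, each row of S
    sums to zero, so the off-diagonal value is -1/(n-1) times the diagonal one
    (sum_tabloids_row_index, sum_tabloids_pair).  Hence the matrix S acts on
    sum-zero vectors as the scalar (N/(n-1)) sum_j lambda_j F(j) G(j).

    The weights w_1, ..., w_k are linearly independent, so there are functions
    D_1, ..., D_k on rows dual to them for the pairing
    (F, G) |-> sum_j lambda_j F(j) G(j) (free_dual_weights).  The profile
    p(x) = ((n-1)/N) sum_l sum_i r_l(i) D_l(x(i)) is then sent to r_l by the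
    voting map of w_l (voting_map_dual_profile).  The voting maps vanish on
    constant profiles because the padded weights sum to zero. *)

Set Implicit Arguments.
Unset Strict Implicit.
Unset Printing Implicit Defensive.

Import GRing.Theory Num.Theory.
Local Open Scope ring_scope.

(** * Tabloids as functions from candidates to rows *)

Definition fiber_rows {n m : nat} (f : 'I_n -> 'I_m) : m.-tuple {set 'I_n} :=
  [tuple [set i | f i == j] | j < m].

Lemma fiber_rowsP (n m : nat) (lambda : m.-tuple nat) (f : 'I_n -> 'I_m) :
  (forall j, #|[set i | f i == j]| = tnth lambda j) ->
  is_tabloid lambda (fiber_rows f).
Proof.
move=> fP; apply/and3P; split.
- by apply/forallP=> j; rewrite tnth_mktuple fP.
- apply/forallP=> j; apply/forallP=> j'; apply/implyP=> jj'.
  rewrite !tnth_mktuple; apply/pred0P=> i /=; rewrite !inE.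
  by case: eqP => // ->; apply/negbTE.
- apply/eqP/setP=> i; rewrite inE; apply/bigcupP.
  by exists (f i); rewrite // tnth_mktuple inE.
Qed.

Definition tabloid_of {n m : nat} {lambda : m.-tuple nat} {f : 'I_n -> 'I_m}
    (fP : forall j, #|[set i | f i == j]| = tnth lambda j) :
    tabloid n lambda :=
  exist _ (fiber_rows f) (fiber_rowsP fP).

Lemma row_index_tabloid_of (n m : nat) (lambda : m.-tuple nat)
    (f : 'I_n -> 'I_m)
    (fP : forall j, #|[set i | f i == j]| = tnth lambda j) (i : 'I_n) :
  row_index (tabloid_of fP) i = f i.
Proof.
by apply/esym/eqP; rewrite -row_indexP tnth_mktuple inE.
Qed.

Lemma row_index_inj (n m : nat) (lambda : m.-tuple nat)
    (x y : tabloid n lambda) : row_index x =1 row_index y -> x = y.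
Proof.
move=> xy; apply/val_inj/eq_from_tnth=> j; apply/setP=> i.
by rewrite !row_indexP xy.
Qed.

Lemma card_row_index (n m : nat) (lambda : m.-tuple nat)
    (x : tabloid n lambda) (j : 'I_m) :
  #|[set i | row_index x i == j]| = tnth lambda j.
Proof.
have /and3P[/forallP/(_ j)/eqP <- _ _] := valP x.
by apply: eq_card => i; rewrite inE row_indexP eq_sym.
Qed.

Lemma sum_row_index (n m : nat) (lambda : m.-tuple nat)
    (x : tabloid n lambda) (F : 'I_m -> rat) :
  \sum_(i < n) F (row_index x i) = \sum_(j < m) (tnth lambda j)%:R * F j.
Proof.
rewrite (partition_big (row_index x) xpredT) //=; apply: eq_bigr => j _.
rewrite -(card_row_index x) -sum1dep_card natr_sum mulr_suml.
by apply: eq_bigr => i /eqP ->; rewrite mul1r.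
Qed.

(** * Padded weighting vectors *)

Lemma size_flatten_nseq (n m : nat) (lambda : m.-tuple nat) (T : Type)
    (a : 'I_m -> T) : is_partition n lambda ->
  size (flatten [seq nseq (tnth lambda j) (a j) | j <- enum 'I_m]) = n.
Proof.
case/and3P=> _ _ /eqP <-; rewrite size_flatten /shape -map_comp.
congr sumn; rewrite -[RHS]map_tnth_enum.
by apply: eq_map => j /=; rewrite size_nseq.
Qed.

(** The entries of the padded vector are those of a list of length exactly n, so
    the sum over its indices is a sum over that list, block by block. *)
Lemma sum_expand (n m : nat) (lambda : m.-tuple nat) (w : 'cV[rat]_m) :
  is_partition n lambda ->
  \sum_(i < n) expand n lambda w i 0 =
    \sum_(j < m) (tnth lambda j)%:R * w j 0.
Proof.
move=> lP; have sz := size_flatten_nseq (fun j => w j 0) lP.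
under eq_bigr => i _ do rewrite mxE.
set s := flatten _ in sz *.
rewrite -(big_mkord xpredT (fun i => nth 0 s i)) -{1}sz -(big_nth 0 xpredT id).
rewrite big_flatten big_map big_enum; apply: eq_bigr => j _.
by rewrite big_nseq iter_addr_0 mulr_natl.
Qed.

(** Fill the rows with consecutive candidates. *)
Lemma card_tabloid_gt0 (n m : nat) (lambda : m.-tuple nat) :
  is_partition n lambda -> (0 < #|{: tabloid n lambda}|)%N.
Proof.
move=> lP; pose s := flatten [seq nseq (tnth lambda j) j | j <- enum 'I_m].
have sz : size s = n := size_flatten_nseq id lP.
pose f (i : 'I_n) := tnth (Tuple (introT eqP sz)) i.
have fP j : #|[set i | f i == j]| = tnth lambda j.
  rewrite cardsE -sum1_card -(big_tuple _ _ (Tuple _) (pred1 j) (fun=> 1%N)) /=.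
  rewrite big_flatten big_map big_enum /= (bigD1 j) //=.
  rewrite [X in (_ + X)%N]big1 ?addn0.
    by rewrite big_nseq_cond /= eqxx iter_addn_0 mul1n.
  by move=> i /negbTE ij; rewrite big_nseq_cond /= ij.
by apply/card_gt0P; exists (tabloid_of fP).
Qed.

(** * Averages over all tabloids *)

Lemma card_relabel (n m : nat) (lambda : m.-tuple nat) (s : {perm 'I_n})
    (x : tabloid n lambda) (j : 'I_m) :
  #|[set i | row_index x (s i) == j]| = tnth lambda j.
Proof.
rewrite -(card_row_index x j) -[RHS](card_preimset _ (@perm_inj _ s)).
by apply: eq_card => i; rewrite !inE.
Qed.

Definition relabel {n m : nat} {lambda : m.-tuple nat} (s : {perm 'I_n})
    (x : tabloid n lambda) : tabloid n lambda :=
  tabloid_of (card_relabel s x).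

Lemma row_index_relabel (n m : nat) (lambda : m.-tuple nat) (s : {perm 'I_n})
    (x : tabloid n lambda) (i : 'I_n) :
  row_index (relabel s x) i = row_index x (s i).
Proof. exact: row_index_tabloid_of. Qed.

Lemma relabel_inj (n m : nat) (lambda : m.-tuple nat) (s : {perm 'I_n}) :
  injective (@relabel n m lambda s).
Proof.
move=> x y xy; apply: row_index_inj => i.
by rewrite -[i](permKV s) -!row_index_relabel xy.
Qed.

(** Relabelling by s is injective on a finite set, hence a bijection of the
    tabloids; this is the symmetry behind every average below. *)
Lemma sum_relabel (n m : nat) (lambda : m.-tuple nat) (s : {perm 'I_n})
    (F : 'I_m -> 'I_m -> rat) (i i' : 'I_n) :
  \sum_(x : tabloid n lambda) F (row_index x (s i)) (row_index x (s i')) =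
  \sum_(x : tabloid n lambda) F (row_index x i) (row_index x i').
Proof.
rewrite [RHS](reindex_inj (@relabel_inj _ _ _ s)) /=.
by apply: eq_bigr => x _; rewrite !row_index_relabel.
Qed.

(** By symmetry all candidates have the same average, so it may be averaged over
    the candidates as well, and each single tabloid then contributes
    the same total. *)
Lemma sum_tabloids_row_index (n m : nat) (lambda : m.-tuple nat)
    (F : 'I_m -> rat) (i : 'I_n) :
  n%:R * \sum_(x : tabloid n lambda) F (row_index x i) =
  #|{: tabloid n lambda}|%:R * \sum_(j < m) (tnth lambda j)%:R * F j.
Proof.
have -> : n%:R * \sum_(x : tabloid n lambda) F (row_index x i) =
    \sum_(i' < n) \sum_(x : tabloid n lambda) F (row_index x i').
  rewrite -{1}[n]card_ord mulr_natl -sumr_const; apply: eq_bigr => i' _.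
  have := @sum_relabel _ _ lambda (tperm i i') (fun j _ => F j) i i.
  by rewrite tpermL.
rewrite exchange_big /= mulr_natl -sumr_const.
by apply: eq_bigr => x _; rewrite sum_row_index.
Qed.

Lemma sum_tabloids_row_index0 (n m : nat) (lambda : m.-tuple nat)
    (F : 'I_m -> rat) (i : 'I_n) :
  \sum_(j < m) (tnth lambda j)%:R * F j = 0 ->
  \sum_(x : tabloid n lambda) F (row_index x i) = 0.
Proof.
move=> F0; have /eqP := @sum_tabloids_row_index _ _ lambda F i.
by rewrite F0 mulr0 mulf_eq0 pnatr_eq0 => /orP[] /eqP // n0; case: i; rewrite n0.
Qed.

(** The transposition of i' and l fixes i, so the sum does not depend on i'
    as long as i' differs from i.  Adding the n - 1 equal off-diagonal sums to the
    diagonal one gives the product of the sum of F(x(i)) over x, which is 0, by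
    the constant total of G over the candidates. *)
Lemma sum_tabloids_pair (n m : nat) (lambda : m.-tuple nat)
    (F G : 'I_m -> rat) (i i' : 'I_n) :
  \sum_(j < m) (tnth lambda j)%:R * F j = 0 -> i' != i ->
  n.-1%:R *
    \sum_(x : tabloid n lambda) F (row_index x i) * G (row_index x i') =
  - \sum_(x : tabloid n lambda) F (row_index x i) * G (row_index x i).
Proof.
move=> F0 i'i; apply/eqP; rewrite -addr_eq0 addrC; apply/eqP.
transitivity (\sum_(l < n) \sum_(x : tabloid n lambda)
    F (row_index x i) * G (row_index x l)).
  rewrite (bigD1 i) //=; congr (_ + _).
  have <- : #|predC1 i| = n.-1 by rewrite cardC1 card_ord.
  rewrite mulr_natl -sumr_const.
  apply: eq_bigr => l li.
  have := @sum_relabel _ _ lambda (tperm i' l) (fun j j' => F j * G j') i i'.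
  by rewrite tpermL tpermD // eq_sym.
rewrite exchange_big /=.
under eq_bigr => x _ do rewrite -mulr_sumr sum_row_index.
by rewrite -mulr_suml sum_tabloids_row_index0 ?mul0r.
Qed.

(** * The voting map *)

(** A right inverse of the matrix of weights is dual to it for the standard
    pairing; dividing its row j by lambda_j turns the standard pairing into the
    one that counts row j with multiplicity lambda_j. *)
Lemma free_dual_weights (n m k : nat) (lambda : m.-tuple nat)
    (w : k.-tuple 'cV[rat]_m) :
  is_partition n lambda -> free w ->
  exists D : 'I_k -> 'I_m -> rat, forall l l' : 'I_k,
    \sum_(j < m) (tnth lambda j)%:R * (tnth w l j 0 * D l' j) = (l == l')%:R.
Proof.
case/and3P=> _ /allP lpos _ /freeP wfree.
pose W : 'M[rat]_(k, m) := \matrix_(l, j) tnth w l j 0.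
have /row_freeP[B WB] : row_free W.
  apply: inj_row_free => v vW; apply/rowP=> l; rewrite mxE.
  apply: (wfree (fun l => v 0 l)); apply/colP=> j.
  move/rowP/(_ j): vW; rewrite !mxE => vW; rewrite summxE -[RHS]vW.
  by apply: eq_bigr => l' _; rewrite !mxE -tnth_nth.
exists (fun l j => B j l / (tnth lambda j)%:R) => l l'.
have := congr1 (fun M : 'M_k => M l l') WB; rewrite !mxE => <-.
apply: eq_bigr => j _; rewrite mxE.
have lj : (tnth lambda j)%:R != 0 :> rat.
  by rewrite pnatr_eq0 -lt0n lpos ?mem_tnth.
by field.
Qed.

(** Coordinate i of the voting map at the profile is a combination of the numbers
    r_l'(i') S l' i', where S l' i' correlates the weight given to i with the dual
    weight of i'.  Since r_l' sums to zero, its part away from i totals -r_l'(i);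
    the two values of S, N/n and -N/(n(n-1)) for l' = l, then combine into
    r_l(i) N/(n-1), and duality removes the terms with l' <> l. *)
Lemma voting_map_dual_profile (n m k : nat) (lambda : m.-tuple nat)
    (w : k.-tuple 'cV[rat]_m) (r : k.-tuple 'cV[rat]_n)
    (D : 'I_k -> 'I_m -> rat) (l : 'I_k) (N := #|{: tabloid n lambda}|) :
  (2 <= n)%N -> (0 < N)%N ->
  \sum_(j < m) (tnth lambda j)%:R * tnth w l j 0 = 0 ->
  (forall l', sum_zero (tnth r l')) ->
  (forall l' : 'I_k,
    \sum_(j < m) (tnth lambda j)%:R * (tnth w l j 0 * D l' j) =
      (l == l')%:R) ->
  voting_map (tnth w l)
    [ffun x : tabloid n lambda => n.-1%:R / N%:R *
       \sum_(l' < k) \sum_(i < n) tnth r l' i 0 * D l' (row_index x i)]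
  = tnth r l.
Proof.
move=> n2 N0 w0 r0 wD; apply/colP=> i; rewrite mxE.
pose S l' i' := \sum_(x : tabloid n lambda)
  tnth w l (row_index x i) 0 * D l' (row_index x i').
have nN0 : N%:R != 0 :> rat by rewrite pnatr_eq0 -lt0n.
have nn0 : n%:R != 0 :> rat by rewrite pnatr_eq0 -lt0n ltnW.
have n10 : n.-1%:R != 0 :> rat by rewrite pnatr_eq0 -lt0n -ltnS prednK // ltnW.
have nE : n%:R = n.-1%:R + 1 :> rat by rewrite natr1 prednK // ltnW.
have Sdiag l' : S l' i = N%:R / n%:R * (l == l')%:R.
  have := @sum_tabloids_row_index _ _ lambda
    (fun j => tnth w l j 0 * D l' j) i.
  by rewrite wD -/(S l' i) -/N => e; apply: (mulfI nn0); rewrite e; field.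
have Soff l' i' : i' != i -> S l' i' = - S l' i / n.-1%:R.
  move=> i'i; apply: (mulfI n10).
  by rewrite (@sum_tabloids_pair _ _ _ (fun j => tnth w l j 0)) // mulrC divfK.
have Ssum l' :
    \sum_(i' < n) tnth r l' i' 0 * S l' i' =
    tnth r l' i 0 * (l == l')%:R * (N%:R / n.-1%:R).
  have := r0 l'; rewrite /sum_zero (bigD1 i) //= => /eqP.
  rewrite addrC addr_eq0 => /eqP rE.
  rewrite (bigD1 i) //= (eq_bigr (fun i' => tnth r l' i' 0 *
    (- S l' i / n.-1%:R))) => [|i' /Soff -> //].
  by rewrite -mulr_suml rE Sdiag nE; field; rewrite n10 -nE nn0.
transitivity (n.-1%:R / N%:R *
    \sum_(l' < k) \sum_(i' < n) tnth r l' i' 0 * S l' i').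
  rewrite mulr_sumr.
  under [RHS]eq_bigr => l' _ do rewrite mulr_sumr.
  under [LHS]eq_bigr => x _ do rewrite ffunE mulrCA mulr_sumr mulr_sumr.
  rewrite exchange_big /=; apply: eq_bigr => l' _.
  under [LHS]eq_bigr => x _ do rewrite !mulr_sumr.
  rewrite exchange_big /=; apply: eq_bigr => i' _.
  by rewrite !mulr_sumr; apply: eq_bigr => x _; ring.
under eq_bigr => l' _ do rewrite Ssum.
rewrite (bigD1 l) //= big1 => [|l' /negbTE l'l]; last first.
  by rewrite eq_sym l'l mulr0 mul0r.
by rewrite eqxx addr0 mulr1; field; rewrite n10 nN0.
Qed.

Theorem theorem1 (n m k : nat) (lambda : m.-tuple nat)
    (w : k.-tuple 'cV[rat]_m) (r : k.-tuple 'cV[rat]_n) :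
  (2 <= n)%N ->
  is_partition n lambda ->
  free w ->
  (forall i : 'I_k, sum_zero (expand n lambda (tnth w i))) ->
  (forall i : 'I_k, sum_zero (tnth r i)) ->
  infinite_set
    [set p : profile n lambda |
      forall i : 'I_k, voting_map (tnth w i) p = tnth r i]%classic.
Proof.
move=> n2 lP wfree w0 r0.
have {}w0 l : \sum_(j < m) (tnth lambda j)%:R * tnth w l j 0 = 0.
  by rewrite -(sum_expand _ lP); apply: w0.
have N0 := card_tabloid_gt0 lP; have /card_gt0P[x0 _] := N0.
have [D wD] := free_dual_weights lP wfree.
pose p0 : profile n lambda :=
  [ffun x : tabloid n lambda => n.-1%:R / #|{: tabloid n lambda}|%:R *
     \sum_(l < k) \sum_(i < n) tnth r l i 0 * D l (row_index x i)].
pose p (c : nat) : profile n lambda :=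
  [ffun x : tabloid n lambda => p0 x + c%:R].
have p_inj : injective p.
  move=> c d /ffunP/(_ x0); rewrite !ffunE => /addrI/eqP.
  by rewrite eqr_nat => /eqP.
have pT c l : voting_map (tnth w l) (p c) = tnth r l.
  rewrite -(@voting_map_dual_profile _ _ _ lambda w r D l n2 N0) //.
  apply/colP=> i; rewrite !mxE.
  under eq_bigr => x _ do rewrite ffunE mulrDr.
  rewrite big_split /= -mulr_suml.
  by rewrite (@sum_tabloids_row_index0 _ _ _ (fun j => tnth w l j 0)) // mul0r addr0.
move=> fin; apply: infinite_nat.
have := finite_preimage (f := p) (in2W p_inj) fin.
by apply: sub_finite_set => c _.
Qed.
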